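(* Let $\mathsf L\in\{\mathsf N_\preccurlyeq,\mathsf{NN}_\preccurlyeq,\mathsf{NT}_\preccurlyeq,\mathsf{NW}_\preccurlyeq,\mathsf{NC}_\preccurlyeq,\mathsf{NA}_\preccurlyeq,\mathsf{NNA}_\preccurlyeq\}$ and let $\mathsf{H.L}$ be the corresponding hypersequent calculus. For every hypersequent $\mathcal H$, if $\mathcal H$ is valid in all $\mathsf L$-models, then $\mathcal H$ is derivable in $\mathsf{H.L}$.
   Context: Language: formulas $A ::= p \mid \bot \mid A\to A \mid A \preccurlyeq A$ over a countable set $Atm$ of atoms; $\top,\neg,\wedge,\vee$ defined as usual. A neighbourhood model is $\mathcal M=\langle W,N,V\rangle$ with $W\ne\emptyset$, $V:Atm\to\mathcal P(W)$, $N:W\to\mathcal P(\mathcal P(W))$ with $\emptyset\notin N(w)$. Forcing: $w\Vdash p$ iff $w\in V(p)$; $w\not\Vdash\bot$; $w\Vdash B\to C$ iff $w\Vdash B$ implies $w\Vdash C$; $w\Vdash B\preccurlyeq C$ iff for all $\alpha\in N(w)$, if some $v\in\alpha$ forces $C$ then some $u\in\alpha$ forces $B$. $\mathcal M\models A$ iff $A$ is forced at all worlds. Conditions (for all $w$): (N) $N(w)\ne\emptyset$; (T) some $\alpha\in N(w)$ contains $w$; (W) $N(w)\ne\emptyset$ and every $\alpha\in N(w)$ contains $w$; (C) $\{w\}\in N(w)$ and every $\alpha\in N(w)$ contains $w$; (A) if $\alpha\in N(w)$ and $v\in\alpha$ then $N(v)=N(w)$. $\mathsf L$-models: $\mathsf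 N_\preccurlyeq$: all; $\mathsf{NN}_\preccurlyeq$: (N); $\mathsf{NT}_\preccurlyeq$: (T); $\mathsf{NW}_\preccurlyeq$: (W); $\mathsf{NC}_\preccurlyeq$: (C); $\mathsf{NA}_\preccurlyeq$: (A); $\mathsf{NNA}_\preccurlyeq$: (N),(A). Hypersequents: a block $[\Sigma\lhd A]$: finite multiset $\Sigma$ of formulas and formula $A$; a sequent with blocks $\Gamma\Rightarrow\Delta$: $\Gamma$ finite multiset of formulas, $\Delta$ finite multiset of formulas and blocks, interpreted as the formula $\bigwedge\Gamma\to\bigvee\Delta'\vee(\bigvee\Sigma_1\preccurlyeq C_1)\vee\dots\vee(\bigvee\Sigma_k\preccurlyeq C_k)$ where $\Delta'$ are the formulas and $[\Sigma_i\lhd C_i]$ the blocks of $\Delta$; a hypersequent is a finite multiset $\Gamma_1\Rightarrow\Delta_1\mid\dots\mid\Gamma_n\Rightarrow\Delta_n$ of these (components); it is valid in $\mathcal M$ if some component's interpretation is valid in $\mathcal M$. Rules ($\mathcal G$ = other components): init: $\mathcal G\mid\Gamma,p\Rightarrow p,\Delta$; $\bot_L$: $\mathcal G\mid\Gamma,\bot\Rightarrow\Delta$; $\to_L$: from $\mathcal G\mid\Gamma,A\to B,B\Rightarrow\Delta$ and $\mathcal G\mid\Gamma,A\to B\Rightarrow\Delta,A$ infer $\mathcal G\mid\Gamma,A\to B\Rightarrow\Delta$; $\to_R$: from $\mathcal G\mid\Gamma,A\Rightarrow\Delta,A\to B,B$ infer $\mathcal G\mid\Gamma\Rightarrow\Delta,A\to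 B$; $\preccurlyeq_L$: from $\mathcal G\mid\Gamma,A\preccurlyeq B\Rightarrow\Delta,[B,\Sigma\lhd C]$ and $\mathcal G\mid\Gamma,A\preccurlyeq B\Rightarrow\Delta,[\Sigma\lhd C],[\Sigma\lhd A]$ infer $\mathcal G\mid\Gamma,A\preccurlyeq B\Rightarrow\Delta,[\Sigma\lhd C]$; $\preccurlyeq_R$: from $\mathcal G\mid\Gamma\Rightarrow\Delta,A\preccurlyeq B,[A\lhd B]$ infer $\mathcal G\mid\Gamma\Rightarrow\Delta,A\preccurlyeq B$; jp: from $\mathcal G\mid\Gamma\Rightarrow\Delta,[\Sigma\lhd A]\mid A\Rightarrow\Sigma$ infer $\mathcal G\mid\Gamma\Rightarrow\Delta,[\Sigma\lhd A]$; N: from $\mathcal G\mid\Gamma\Rightarrow\Delta,[\bot\lhd\top]$ infer $\mathcal G\mid\Gamma\Rightarrow\Delta$; T: from $\mathcal G\mid\Gamma,A\preccurlyeq B\Rightarrow\Delta,B$ and $\mathcal G\mid\Gamma,A\preccurlyeq B\Rightarrow\Delta,[\bot\lhd A]$ infer $\mathcal G\mid\Gamma,A\preccurlyeq B\Rightarrow\Delta$; W: from $\mathcal G\mid\Gamma\Rightarrow\Delta,[\Sigma\lhd A],\Sigma$ infer $\mathcal G\mid\Gamma\Rightarrow\Delta,[\Sigma\lhd A]$; C: from $\mathcal G\mid\Gamma,A\preccurlyeq B\Rightarrow\Delta,B$ and $\mathcal G\mid\Gamma,A\preccurlyeq B,A\Rightarrow\Delta$ infer $\mathcal G\mid\Gamma,A\preccurlyeq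 B\Rightarrow\Delta$; $\mathrm A_L$: from $\mathcal G\mid\Gamma,A\preccurlyeq B\Rightarrow\Delta\mid\Omega,A\preccurlyeq B\Rightarrow\Theta$ infer $\mathcal G\mid\Gamma,A\preccurlyeq B\Rightarrow\Delta\mid\Omega\Rightarrow\Theta$; $\mathrm A_R$: from $\mathcal G\mid\Gamma\Rightarrow\Delta,A\preccurlyeq B\mid\Omega\Rightarrow\Theta,A\preccurlyeq B$ infer $\mathcal G\mid\Gamma\Rightarrow\Delta,A\preccurlyeq B\mid\Omega\Rightarrow\Theta$. $\mathsf{H.N}=\{\mathrm{init},\bot_L,\to_L,\to_R,\preccurlyeq_L,\preccurlyeq_R,\mathrm{jp}\}$; $\mathsf{H.NN}=\mathsf{H.N}+$N; $\mathsf{H.NT}=\mathsf{H.N}+$T; $\mathsf{H.NW}=\mathsf{H.N}+$T,W; $\mathsf{H.NC}=\mathsf{H.N}+$W,C; $\mathsf{H.NA}=\mathsf{H.N}+\mathrm A_L,\mathrm A_R$; $\mathsf{H.NNA}=\mathsf{H.NN}+\mathrm A_L,\mathrm A_R$. The calculus for $\mathsf NX_\preccurlyeq$ is $\mathsf{H.N}X$. *)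

(* Defs.v *)
From HB Require Import structures.
From mathcomp Require Import all_boot.
From mathcomp Require Import finmap multiset.
From mathcomp Require Import boolp classical_sets.

Set Implicit Arguments.
Unset Strict Implicit.
Unset Printing Implicit Defensive.

Declare Scope form_pref_scope.
Delimit Scope form_pref_scope with F.

Inductive form (Atm : Type) : Type :=
| Var of Atm
| Bot
| Imp of form Atm & form Atm
| Pref of form Atm & form Atm.

Arguments Bot {Atm}.

Notation "A → B" := (Imp A B)
  (at level 60, right associativity) : form_pref_scope.
Notation "A ≼ B" := (Pref A B)
  (at level 55, no associativity) : form_pref_scope.

Section FormChoice.
Variable Atm : countType.

Fixpoint form_encode (A : form Atm) : GenTree.tree Atm :=
  match A with
  | Var p => GenTree.Leaf p
  | Bot => GenTree.Node 0 [::]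
  | Imp B C => GenTree.Node 1 [:: form_encode B; form_encode C]
  | Pref B C => GenTree.Node 2 [:: form_encode B; form_encode C]
  end.

Fixpoint form_decode (t : GenTree.tree Atm) : form Atm :=
  match t with
  | GenTree.Leaf p => Var p
  | GenTree.Node 1 [:: t1; t2] => Imp (form_decode t1) (form_decode t2)
  | GenTree.Node 2 [:: t1; t2] => Pref (form_decode t1) (form_decode t2)
  | GenTree.Node _ _ => Bot
  end.

Lemma form_encodeK : cancel form_encode form_decode.
Proof. by elim=> //= [B -> C ->|B -> C ->]. Qed.

HB.instance Definition _ := Countable.copy (form Atm) (can_type form_encodeK).

End FormChoice.

Section Connectives.
Variable Atm : Type.
Implicit Types (A B : form Atm) (s : seq (form Atm)).

Definition Neg A : form Atm := Imp A Bot.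
Definition Top : form Atm := Neg Bot.
Definition Or A B : form Atm := Imp (Neg A) B.
Definition And A B : form Atm := Neg (Imp A (Neg B)).

Definition bigAnd s : form Atm := foldr And Top s.
Definition bigOr s : form Atm := foldr Or Bot s.

End Connectives.

Arguments Top {Atm}.

Section Semantics.
Local Open Scope classical_set_scope.

Record model (Atm : Type) := Model {
  world : Type;
  nbhd : world -> set (set world);
  val_atm : Atm -> set world;
  world_inhabited : inhabited world;
  nbhd_nonempty : forall w, ~ nbhd w set0
}.

Fixpoint forces (Atm : Type) (M : model Atm) (w : world M) (A : form Atm)
    : Prop :=
  match A with
  | Var p => val_atm p w
  | Bot => False
  | Imp B C => forces w B -> forces w C
  | Pref B C => forall a : set (world M), nbhd w a ->
      (exists2 v, a v & forces v C) -> (exists2 u, a u & forces u B)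
  end.

Definition valid_form (Atm : Type) (M : model Atm) (A : form Atm) : Prop :=
  forall w : world M, forces w A.

Section Conditions.
Variables (Atm : Type) (M : model Atm).

Definition condN : Prop := forall w : world M, exists a, nbhd w a.
Definition condT : Prop := forall w : world M, exists2 a, nbhd w a & a w.
Definition condW : Prop := forall w : world M,
  (exists a, nbhd w a) /\ (forall a, nbhd w a -> a w).
Definition condC : Prop := forall w : world M,
  nbhd w [set w] /\ (forall a, nbhd w a -> a w).
Definition condA : Prop := forall (w : world M) (a : set (world M)) (v : world M),
  nbhd w a -> a v -> nbhd v = nbhd w.

End Conditions.
End Semantics.

Inductive logic := LN | LNN | LNT | LNW | LNC | LNA | LNNA.

Definition logic_model (L : logic) (Atm : Type) (M : model Atm) : Prop :=
  match L with
  | LN => True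
  | LNN => condN M
  | LNT => condT M
  | LNW => condW M
  | LNC => condC M
  | LNA => condA M
  | LNNA => condN M /\ condA M
  end.

Section Hypersequents.
Local Open Scope mset_scope.
Variable Atm : countType.

(* (Sigma, A) is the block [Sigma ◁ A]. *)
Definition block : Type := ({mset form Atm} * form Atm)%type.
HB.instance Definition _ := Choice.on block.

Definition succ_item : Type := (form Atm + block)%type.
HB.instance Definition _ := Choice.on succ_item.

(* (Gamma, Delta) is the sequent with blocks Gamma ⇒ Delta. *)
Definition sequent : Type := ({mset form Atm} * {mset succ_item})%type.
HB.instance Definition _ := Choice.on sequent.

Definition hypersequent : Type := {mset sequent}.

Definition fm (A : form Atm) : succ_item := inl A.
Definition blk (S : {mset form Atm}) (A : form Atm) : succ_item := inr (S, A).

Definition sq (G : {mset form Atm}) (D : {mset succ_item}) : sequent := (G, D).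

Definition fms (S : {mset form Atm}) : {mset succ_item} :=
  seq_mset [seq fm A | A <- S].

Definition item_form (x : succ_item) : option (form Atm) :=
  if x is inl A then Some A else None.
Definition item_block (x : succ_item) : option block :=
  if x is inr b then Some b else None.

(* The conjunctions and disjunctions over a multiset are taken in the order of
   the library's enumeration [enum_mset]; another order gives an equivalent
   formula. *)
Definition block_interp (b : block) : form Atm := Pref (bigOr b.1) b.2.

Definition sequent_interp (s : sequent) : form Atm :=
  Imp (bigAnd s.1)
      (bigOr (pmap item_form s.2 ++
              [seq block_interp b | b <- pmap item_block s.2])).

Definition valid_hyp (M : model Atm) (H : hypersequent) : Prop :=
  exists2 s : sequent, s \in H & valid_form M (sequent_interp s).

End Hypersequents.

Definition has_ruleN (L : logic) : bool :=
  if L is (LNN | LNNA) then true else false.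
Definition has_ruleT (L : logic) : bool :=
  if L is (LNT | LNW) then true else false.
Definition has_ruleW (L : logic) : bool :=
  if L is (LNW | LNC) then true else false.
Definition has_ruleC (L : logic) : bool :=
  if L is LNC then true else false.
Definition has_ruleA (L : logic) : bool :=
  if L is (LNA | LNNA) then true else false.

Declare Scope hyp_scope.
Delimit Scope hyp_scope with H.

Notation "Γ ⇒ Δ" := (sq Γ Δ)
  (at level 70, no associativity) : hyp_scope.
Notation "[ S ◁ A ]" := (blk S A)
  (at level 0, S at level 69, A at level 69, format "[ S  ◁  A ]") : hyp_scope.

Section Calculus.
Local Open Scope mset_scope.
Local Open Scope form_pref_scope.
Local Open Scope hyp_scope.
Variables (Atm : countType) (L : logic).

Inductive derivable : hypersequent Atm -> Prop :=
| r_init (G : hypersequent Atm) Γ Δ p :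
    derivable ((Var p +` Γ ⇒ fm (Var p) +` Δ) +` G)
| r_botL (G : hypersequent Atm) Γ Δ :
    derivable ((Bot +` Γ ⇒ Δ) +` G)
| r_impL (G : hypersequent Atm) Γ Δ A B :
    derivable ((B +` ((A → B) +` Γ) ⇒ Δ) +` G) ->
    derivable (((A → B) +` Γ ⇒ fm A +` Δ) +` G) ->
    derivable (((A → B) +` Γ ⇒ Δ) +` G)
| r_impR (G : hypersequent Atm) Γ Δ A B :
    derivable ((A +` Γ ⇒ fm B +` (fm (A → B) +` Δ)) +` G) ->
    derivable ((Γ ⇒ fm (A → B) +` Δ) +` G)
| r_prefL (G : hypersequent Atm) Γ Δ S A B C :
    derivable (((A ≼ B) +` Γ ⇒ [B +` S ◁ C] +` Δ) +` G) ->
    derivable (((A ≼ B) +` Γ ⇒ [S ◁ A] +` ([S ◁ C] +` Δ)) +` G) ->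
    derivable (((A ≼ B) +` Γ ⇒ [S ◁ C] +` Δ) +` G)
| r_prefR (G : hypersequent Atm) Γ Δ A B :
    derivable ((Γ ⇒ [[mset A] ◁ B] +` (fm (A ≼ B) +` Δ)) +` G) ->
    derivable ((Γ ⇒ fm (A ≼ B) +` Δ) +` G)
| r_jp (G : hypersequent Atm) Γ Δ S A :
    derivable (([mset A] ⇒ fms S) +` ((Γ ⇒ [S ◁ A] +` Δ) +` G)) ->
    derivable ((Γ ⇒ [S ◁ A] +` Δ) +` G)
| r_N (G : hypersequent Atm) Γ Δ : has_ruleN L ->
    derivable ((Γ ⇒ [[mset Bot] ◁ Top] +` Δ) +` G) ->
    derivable ((Γ ⇒ Δ) +` G)
| r_T (G : hypersequent Atm) Γ Δ A B : has_ruleT L ->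
    derivable (((A ≼ B) +` Γ ⇒ fm B +` Δ) +` G) ->
    derivable (((A ≼ B) +` Γ ⇒ [[mset Bot] ◁ A] +` Δ) +` G) ->
    derivable (((A ≼ B) +` Γ ⇒ Δ) +` G)
| r_W (G : hypersequent Atm) Γ Δ S A : has_ruleW L ->
    derivable ((Γ ⇒ fms S `+` ([S ◁ A] +` Δ)) +` G) ->
    derivable ((Γ ⇒ [S ◁ A] +` Δ) +` G)
| r_C (G : hypersequent Atm) Γ Δ A B : has_ruleC L ->
    derivable (((A ≼ B) +` Γ ⇒ fm B +` Δ) +` G) ->
    derivable ((A +` ((A ≼ B) +` Γ) ⇒ Δ) +` G) ->
    derivable (((A ≼ B) +` Γ ⇒ Δ) +` G)
| r_AL (G : hypersequent Atm) Γ Δ Ω Θ A B : has_ruleA L ->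
    derivable (((A ≼ B) +` Γ ⇒ Δ) +` (((A ≼ B) +` Ω ⇒ Θ) +` G)) ->
    derivable (((A ≼ B) +` Γ ⇒ Δ) +` ((Ω ⇒ Θ) +` G))
| r_AR (G : hypersequent Atm) Γ Δ Ω Θ A B : has_ruleA L ->
    derivable ((Γ ⇒ fm (A ≼ B) +` Δ) +` ((Ω ⇒ fm (A ≼ B) +` Θ) +` G)) ->
    derivable ((Γ ⇒ fm (A ≼ B) +` Δ) +` ((Ω ⇒ Θ) +` G)).

End Calculus.

(* Main.v *)
Require Import Defs.
From mathcomp Require Import boolp classical_sets.
From mathcomp Require Import all_boot.
From mathcomp Require Import finmap multiset.

(** Order hypersequents by support: a component lies below another when its
    antecedent, its succedent formulas and, blockwise, the left parts of its
    blocks are included in those of the other. The rules read upwards only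
    climb in this order and stay within the finite set [F] of subformulas of
    [H], [⊥] and [⊤]; up to support there are finitely many hypersequents over
    [F], so an underivable [H] lies below a maximal underivable one. Its maximal
    components are saturated and serve as worlds. The neighbourhoods of [w] are
    the sets of all worlds refuting [S], for each maximal block [S ◁ A] of [w]:
    the rule jp provides a world forcing [A] in this set. Rules T, C and A are
    matched by adding a reflexive neighbourhood, adding [{w}], and sharing the
    blocks of all worlds, respectively. *)

Set Implicit Arguments.
Unset Strict Implicit.
Unset Printing Implicit Defensive.

Local Open Scope mset_scope.
Local Open Scope form_pref_scope.
Local Open Scope hyp_scope.

(** * Support order on hypersequents *)

Section SupportOrder.
Variable Atm : countType.
Implicit Types (A B C : form Atm) (S Γ : {mset form Atm}).
Implicit Types (x y : succ_item Atm) (D E Δ : {mset succ_item Atm}).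
Implicit Types (c d e : sequent Atm) (G H K : hypersequent Atm).

(** Blocks are compared by inclusion of left parts because the first premise of [≼] on the left
    enlarges a block in place; plain membership would not put that premise above its conclusion. *)
Definition item_le x y : Prop :=
  match x, y with
  | inl A, inl B => A = B
  | inr s, inr t => {subset s.1 <= t.1} /\ s.2 = t.2
  | _, _ => False
  end.

Definition items_le D E : Prop :=
  forall x, x \in D -> exists2 y, y \in E & item_le x y.

Definition seq_le c d : Prop := {subset c.1 <= d.1} /\ items_le c.2 d.2.

Definition hyp_le H K : Prop :=
  forall c, c \in H -> exists2 d, d \in K & seq_le c d.

Lemma item_le_refl x : item_le x x.
Proof. by case: x => [A|s] //=; split. Qed.

Lemma item_le_trans y x z : item_le x y -> item_le y z -> item_le x z.
Proof.
case: x y z => [A|s] [B|t] [C|u] //=; first by move=> ->.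
by move=> [st ->] [tu ->]; split=> // A /st /tu.
Qed.

Lemma items_le_refl D : items_le D D.
Proof. by move=> x xD; exists x => //; apply: item_le_refl. Qed.

Lemma items_le_trans E D F : items_le D E -> items_le E F -> items_le D F.
Proof.
move=> DE EF x /DE [y /EF [z zF yz] xy].
by exists z => //; apply: item_le_trans yz.
Qed.

Lemma seq_le_refl c : seq_le c c.
Proof. by split=> //; apply: items_le_refl. Qed.

Lemma seq_le_trans d c e : seq_le c d -> seq_le d e -> seq_le c e.
Proof.
move=> [cd1 cd2] [de1 de2]; split; last exact: items_le_trans de2.
by move=> A /cd1 /de1.
Qed.

Lemma hyp_le_refl H : hyp_le H H.
Proof. by move=> c cH; exists c => //; apply: seq_le_refl. Qed.

Lemma hyp_le_trans K H G : hyp_le H K -> hyp_le K G -> hyp_le H G.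
Proof.
move=> HK KG c /HK [d /KG [e eG de] cd].
by exists e => //; apply: seq_le_trans de.
Qed.

Lemma subset1D (pT : predType (form Atm)) (P : pT) A S :
  A \in P -> {subset S <= P} -> {subset A +` S <= P}.
Proof. by move=> AP sub B; rewrite in_mset1D => /orP[/eqP -> | /sub]. Qed.

Lemma subset_add A S Γ : {subset S <= Γ} -> {subset S <= A +` Γ}.
Proof. by move=> sub B /sub; apply: mset1Dr. Qed.

Lemma items_le_add x D E : items_le D E -> items_le D (x +` E).
Proof. by move=> le y /le [z zE yz]; exists z => //; apply: mset1Dr. Qed.

Lemma mem_fms S A : (fm A \in fms S) = (A \in S).
Proof.
rewrite /fms (perm_mem (perm_eq_seq_mset _)).
by rewrite mem_map // => B C [].
Qed.

Lemma fmsP S x : x \in fms S -> exists2 A, A \in S & x = fm A.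
Proof. by rewrite /fms (perm_mem (perm_eq_seq_mset _)) => /mapP. Qed.

Lemma items_le_catr D E F : items_le D F -> items_le D (E `+` F).
Proof. by move=> le x /le [y yF xy]; exists y => //; rewrite in_msetD yF orbT. Qed.

Lemma items_le_inl D E A : items_le D E -> fm A \in D -> fm A \in E.
Proof. by move=> le /le [[B|t] //= yE ->]. Qed.

Lemma items_le_inr D E S A : items_le D E -> [S ◁ A] \in D ->
  exists2 T : {mset form Atm}, [T ◁ A] \in E & {subset S <= T}.
Proof. by move=> le /le [[B|[T B]] //= yE [sub eqA]]; exists T; rewrite ?eqA. Qed.

(** The shape of the first premise of [≼] on the left: one copy of the block gives way to a larger
    one. *)
Lemma items_le_grow D S (T : {mset form Atm}) A : {subset S <= T} ->
  items_le D ([T ◁ A] +` (D `\ [S ◁ A])).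
Proof.
move=> sub x xD; case: (eqVneq x [S ◁ A]) => [->|neq].
  by exists [T ◁ A]; rewrite ?mset1D1.
exists x; last exact: item_le_refl.
by rewrite in_mset1D in_msetB1 (negbTE neq) xD orbT.
Qed.

Lemma hyp_le_repl K d d1 : seq_le d d1 -> hyp_le K (d1 +` (K `\ d)).
Proof.
move=> dd1 c cK; case: (eqVneq c d) => [->|neq].
  by exists d1; rewrite ?mset1D1.
exists c; last exact: seq_le_refl.
by rewrite in_mset1D in_msetB1 (negbTE neq) cK orbT.
Qed.

End SupportOrder.

(** * Rules applied to components and formulas located by membership *)

Section Rules.
Variables (Atm : countType) (L : logic).
Implicit Types (A B C : form Atm) (S Γ : {mset form Atm}).
Implicit Types (Δ : {mset succ_item Atm}) (H K : hypersequent Atm).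
Notation derivable := (@derivable Atm L).

Lemma init_in H Γ Δ p :
  (Γ ⇒ Δ) \in H -> Var p \in Γ -> fm (Var p) \in Δ -> derivable H.
Proof.
by move=> /msetB1K <- /msetB1K <- /msetB1K <-; apply: r_init.
Qed.

Lemma botL_in H Γ Δ : (Γ ⇒ Δ) \in H -> Bot \in Γ -> derivable H.
Proof. by move=> /msetB1K <- /msetB1K <-; apply: r_botL. Qed.

(** The rule keeps its principal formula, so [msetB1K] restores the whole of [Γ] in both premises,
    which therefore only grow. *)
Lemma impL_in H Γ Δ A B : (Γ ⇒ Δ) \in H -> A → B \in Γ ->
  derivable ((B +` Γ ⇒ Δ) +` (H `\ (Γ ⇒ Δ))) ->
  derivable ((Γ ⇒ fm A +` Δ) +` (H `\ (Γ ⇒ Δ))) -> derivable H.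
Proof.
move=> cH ABΓ; rewrite -[in derivable H](msetB1K cH) -(msetB1K ABΓ).
exact: r_impL.
Qed.

Lemma impR_in H Γ Δ A B : (Γ ⇒ Δ) \in H -> fm (A → B) \in Δ ->
  derivable ((A +` Γ ⇒ fm B +` Δ) +` (H `\ (Γ ⇒ Δ))) -> derivable H.
Proof.
move=> cH ABΔ; rewrite -[in derivable H](msetB1K cH) -(msetB1K ABΔ).
exact: r_impR.
Qed.

Lemma prefL_in H Γ Δ S A B C : (Γ ⇒ Δ) \in H -> A ≼ B \in Γ ->
  [S ◁ C] \in Δ ->
  derivable ((Γ ⇒ [B +` S ◁ C] +` (Δ `\ [S ◁ C])) +` (H `\ (Γ ⇒ Δ))) ->
  derivable ((Γ ⇒ [S ◁ A] +` Δ) +` (H `\ (Γ ⇒ Δ))) -> derivable H.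
Proof.
move=> cH ABΓ SCΔ; rewrite -[in derivable H](msetB1K cH) -(msetB1K ABΓ).
(* Occurrence 1 of [Δ] is left alone: there the block is already removed, to be replaced by its
   enlargement. *)
rewrite -{2 3 4 5 6}(msetB1K SCΔ).
exact: r_prefL.
Qed.

Lemma prefR_in H Γ Δ A B : (Γ ⇒ Δ) \in H -> fm (A ≼ B) \in Δ ->
  derivable ((Γ ⇒ [[mset A] ◁ B] +` Δ) +` (H `\ (Γ ⇒ Δ))) -> derivable H.
Proof.
move=> cH ABΔ; rewrite -[in derivable H](msetB1K cH) -(msetB1K ABΔ).
exact: r_prefR.
Qed.

Lemma jp_in H Γ Δ S A : (Γ ⇒ Δ) \in H -> [S ◁ A] \in Δ ->
  derivable (([mset A] ⇒ fms S) +` H) -> derivable H.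
Proof.
by move=> /msetB1K <- /msetB1K <-; apply: r_jp.
Qed.

Lemma N_in H Γ Δ : has_ruleN L -> (Γ ⇒ Δ) \in H ->
  derivable ((Γ ⇒ [[mset Bot] ◁ Top] +` Δ) +` (H `\ (Γ ⇒ Δ))) -> derivable H.
Proof.
by move=> rL cH; rewrite -[in derivable H](msetB1K cH); apply: r_N.
Qed.

Lemma T_in H Γ Δ A B : has_ruleT L -> (Γ ⇒ Δ) \in H -> A ≼ B \in Γ ->
  derivable ((Γ ⇒ fm B +` Δ) +` (H `\ (Γ ⇒ Δ))) ->
  derivable ((Γ ⇒ [[mset Bot] ◁ A] +` Δ) +` (H `\ (Γ ⇒ Δ))) -> derivable H.
Proof.
move=> rL cH ABΓ; rewrite -[in derivable H](msetB1K cH) -(msetB1K ABΓ).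
exact: r_T.
Qed.

Lemma W_in H Γ Δ S A : has_ruleW L -> (Γ ⇒ Δ) \in H -> [S ◁ A] \in Δ ->
  derivable ((Γ ⇒ fms S `+` Δ) +` (H `\ (Γ ⇒ Δ))) -> derivable H.
Proof.
move=> rL cH SAΔ; rewrite -[in derivable H](msetB1K cH) -(msetB1K SAΔ).
exact: r_W.
Qed.

Lemma C_in H Γ Δ A B : has_ruleC L -> (Γ ⇒ Δ) \in H -> A ≼ B \in Γ ->
  derivable ((Γ ⇒ fm B +` Δ) +` (H `\ (Γ ⇒ Δ))) ->
  derivable ((A +` Γ ⇒ Δ) +` (H `\ (Γ ⇒ Δ))) -> derivable H.
Proof.
move=> rL cH ABΓ; rewrite -[in derivable H](msetB1K cH) -(msetB1K ABΓ).
exact: r_C.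
Qed.

(** The inequality ensures that [c] survives the removal of [Γ ⇒ Δ], so the rule has two separate
    occurrences to act on. *)
Lemma AL_in H c Γ Δ A B : has_ruleA L -> c \in H -> (Γ ⇒ Δ) \in H ->
  A ≼ B \in c.1 -> c != (Γ ⇒ Δ) ->
  derivable (((A ≼ B) +` Γ ⇒ Δ) +` (H `\ (Γ ⇒ Δ))) -> derivable H.
Proof.
case: c => Γ' Δ' rL cH eH /= ABΓ neq.
have {}cH : (Γ' ⇒ Δ') \in H `\ (Γ ⇒ Δ).
  by rewrite in_msetB1 (negbTE neq) cH.
rewrite -[in derivable H](msetB1K eH) -(msetB1K cH) -(msetB1K ABΓ).
rewrite msetDCA => hd; rewrite msetDCA; exact: r_AL hd.
Qed.

End Rules.
(** Each strict step up strictly shrinks the complement of [f x] in the finite type [T]; induct on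
    its cardinality. It is applied to hypersequents, to components and to blocks. *)
Lemma exists_maximal (X : Type) (T : finType) (P : X -> Prop)
    (le : X -> X -> Prop) (f : X -> {set T}) :
  (forall x, le x x) -> (forall y x z, le x y -> le y z -> le x z) ->
  (forall x y, P x -> P y -> (le x y <-> f x \subset f y)) ->
  forall x, P x ->
  exists m, [/\ P m, le x m & forall y, P y -> le m y -> le y m].
Proof.
move=> le_refl le_trans lef x; have [n] := ubnP #|~: f x|.
elim: n x => // n IHn x; rewrite ltnS => le_n Px.
have [[y [Py xy nyx]]|no] := pselect (exists y, [/\ P y, le x y & ~ le y x]).
  have [|//|m [Pm ym mmax]] := IHn y.
    apply: leq_trans le_n; apply: proper_card.
    rewrite properE !setCS (lef x y Px Py).1 //=.
    by apply/negP => /(lef y x Py Px).2.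
  by exists m; split=> //; apply: le_trans ym.
exists x; split=> // y Py xy; apply: contrapT => nyx.
by apply: no; exists y.
Qed.

(** * Maximal underivable hypersequents *)

Section Shapes.
Variables (Atm : countType) (F : seq (form Atm)).
Implicit Types (A B C : form Atm) (S T Γ : {mset form Atm}).
Implicit Types (c d : sequent Atm) (H K : hypersequent Atm).

Definition item_over (x : succ_item Atm) : Prop :=
  match x return Prop with
  | inl A => A \in F
  | inr s => {subset s.1 <= F} /\ s.2 \in F
  end.

Definition seq_over c : Prop :=
  {subset c.1 <= F} /\ forall x, x \in c.2 -> item_over x.

Definition hyp_over H : Prop := forall c, c \in H -> seq_over c.

Definition shape : finType :=
  ({set seq_sub F} * {set seq_sub F + {set seq_sub F} * seq_sub F})%type.

Definition trace S : {set seq_sub F} := [set a | val a \in S].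

(** Inclusion [U \subset trace S], rather than equality, makes this upward closed in [c] for
    [seq_le]. *)
Definition shape_in (k : shape) c : Prop :=
  (forall a, a \in k.1 -> val a \in c.1) /\
  forall y, y \in k.2 ->
    match y return Prop with
    | inl a => fm (val a) \in c.2
    | inr (U, a) => exists2 S, [S ◁ val a] \in c.2 & U \subset trace S
    end.

Definition shape_of c : shape :=
  (trace c.1,
   [set y | match y with
            | inl a => fm (val a) \in c.2
            | inr (U, a) => `[< exists2 S, [S ◁ val a] \in c.2 & U = trace S >]
            end]).

Lemma subset_trace S T : {subset S <= F} ->
  {subset S <= T} <-> trace S \subset trace T.
Proof.
move=> SF; split=> [ST|/subsetP ST A AS].
  by apply/subsetP => a; rewrite !inE => /ST.
by have := ST (SeqSub (SF _ AS)); rewrite !inE; apply.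
Qed.

Lemma shape_of_in c : shape_in (shape_of c) c.
Proof.
split=> [a|]; first by rewrite inE.
move=> [a|[U a]]; rewrite inE //= => /asboolP[S Sc ->].
by exists S.
Qed.

Lemma shape_in_le k c d : shape_in k c -> seq_le c d -> shape_in k d.
Proof.
move=> [k1 k2] [le1 le2]; split=> [a /k1 /le1 //|y /k2].
case: y => [a|[U a] [S Sc US]]; first exact: items_le_inl.
have [T Td ST] := items_le_inr le2 Sc.
exists T => //; apply: subset_trans US _.
by apply/subsetP => b; rewrite !inE => /ST.
Qed.

Lemma seq_le_shape c d : seq_over c -> shape_in (shape_of c) d -> seq_le c d.
Proof.
move=> [ov1 ov2] [le1 le2]; split=> [A Ac|[A|[S A]] xc].
- by have := le1 (SeqSub (ov1 _ Ac)); rewrite inE; apply.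
- have AF : A \in F := ov2 _ xc.
  exists (fm A) => //; have := le2 (inl (SeqSub AF)).
  by rewrite inE /=; apply.
- have [/= SF AF] := ov2 _ xc.
  have := le2 (inr (trace S, SeqSub AF)).
  rewrite inE /= => -[|T Td /(subset_trace T SF).2 ST].
    by apply/asboolP; exists S.
  by exists [T ◁ A].
Qed.

(** A sequent is represented by all shapes below it: [shape_of] itself is not monotone, since a
    growing block changes its left set, whereas inclusion of these sets matches [seq_le]. *)
Definition seq_shapes c : {set shape} := [set k | `[< shape_in k c >]].
Definition hyp_shapes H : {set shape} :=
  [set k | `[< exists2 c, c \in H & shape_in k c >]].

(** Conversely, [shape_of c] is one of the shapes of [c], and its presence below [d] already forces
    [seq_le c d]. *)
Lemma seq_le_shapes c d : seq_over c ->
  seq_le c d <-> seq_shapes c \subset seq_shapes d.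
Proof.
move=> ov; split=> [cd|/subsetP sub].
  apply/subsetP => k; rewrite !inE => /asboolP kc; apply/asboolP.
  exact: shape_in_le cd.
apply: seq_le_shape => //.
have := sub (shape_of c); rewrite !inE => /(_ _)/asboolP; apply.
by apply/asboolP; apply: shape_of_in.
Qed.

Lemma hyp_le_shapes H K : hyp_over H ->
  hyp_le H K <-> hyp_shapes H \subset hyp_shapes K.
Proof.
move=> ov; split=> [HK|/subsetP sub].
  apply/subsetP => k; rewrite !inE => /asboolP[c /HK[d dK cd] kc].
  by apply/asboolP; exists d => //; apply: shape_in_le cd.
move=> c cH; have := sub (shape_of c); rewrite !inE => /(_ _)/asboolP[].
  by apply/asboolP; exists c => //; apply: shape_of_in.
by move=> d dK cd; exists d => //; apply: seq_le_shape => //; apply: ov.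
Qed.

End Shapes.

Lemma forces_bigAnd (Atm : countType) (M : model Atm) (w : world M) s :
  (forall A, A \in s -> forces w A) -> forces w (bigAnd s).
Proof.
elim: s => [_ //|A s IHs all] /= AB.
apply: AB; first by apply: all; rewrite mem_head.
by apply: IHs => B Bs; apply: all; rewrite inE Bs orbT.
Qed.

Lemma forces_bigOr (Atm : countType) (M : model Atm) (w : world M) s :
  forces w (bigOr s) -> exists2 A, A \in s & forces w A.
Proof.
elim: s => [//|A s IHs] /= AB; have [fA|nfA] := pselect (forces w A).
  by exists A; rewrite ?mem_head.
by have [B Bs fB] := IHs (AB nfA); exists B => //; rewrite inE Bs orbT.
Qed.

(** * Saturation of maximal components *)

Section Saturation.
Variables (Atm : countType) (L : logic) (F : seq (form Atm)).
Variable H : hypersequent Atm.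
Implicit Types (A B C : form Atm) (S T Γ : {mset form Atm}).
Implicit Types (c d : sequent Atm) (K : hypersequent Atm).
Notation derivable := (@derivable Atm L).

Hypothesis Bot_F : Bot \in F.
Hypothesis Top_F : Top \in F.
Hypothesis Imp_F : forall A B, A → B \in F -> A \in F /\ B \in F.
Hypothesis Pref_F : forall A B, A ≼ B \in F -> A \in F /\ B \in F.
Hypothesis H_over : hyp_over F H.
Hypothesis H_und : ~ derivable H.
Hypothesis H_max :
  forall K, hyp_over F K -> ~ derivable K -> hyp_le H K -> hyp_le K H.

(** An extension of a non-maximal component may lie below some other component, so it yields no
    contradiction with maximality of [H]. *)
Definition maximal_in c : Prop :=
  c \in H /\ forall d, d \in H -> seq_le c d -> seq_le d c.

Definition maximal_block c S A : Prop :=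
  [S ◁ A] \in c.2 /\
  forall T, [T ◁ A] \in c.2 -> {subset S <= T} -> {subset T <= S}.

Lemma exists_maximal_in c : c \in H -> exists2 d, maximal_in d & seq_le c d.
Proof.
move=> cH.
have [|d [dH cd dmax]] := exists_maximal (@seq_le_refl Atm)
  (@seq_le_trans Atm) _ cH (P := fun c => c \in H) (f := @seq_shapes _ F).
  by move=> x y xH _; apply: seq_le_shapes; apply: H_over.
by exists d.
Qed.

Lemma exists_maximal_block c S A : c \in H -> [S ◁ A] \in c.2 ->
  exists2 T, maximal_block c T A & {subset S <= T}.
Proof.
move=> cH Sc.
have [| | |T [Tc ST Tmax]] := exists_maximal _ _ _ Sc
  (P := fun T => [T ◁ A] \in c.2) (le := fun S T => {subset S <= T})
  (f := @trace _ F).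
- by move=> U A'.
- by move=> V U W UV VW x /UV /VW.
- move=> U V Uc _; apply: subset_trace.
  by have [] := (H_over cH).2 _ Uc.
- by exists T.
Qed.

(** Otherwise maximality of [H] puts [d] below some [e] in [H]; then [c] lies below [e], maximality
    of [c] puts [e] below [c], and so [d] below [c]. Saturation follows: were it to fail, all
    premises of the rule would be derivable, and hence [H]. *)
Lemma extension_derivable c d :
  maximal_in c -> seq_le c d -> seq_over F d -> ~ seq_le d c ->
  derivable (d +` (H `\ c)).
Proof.
move=> [cH cmax] cd ov ndc; apply: contrapT => und; apply: ndc.
have HK := hyp_le_repl (K := H) cd.
have [|e eH de] := H_max _ und HK (mset1D1 _ _).
- move=> e; rewrite in_mset1D => /orP[/eqP -> //|].
  by rewrite in_msetB1 => /andP[_ /H_over].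
- exact: seq_le_trans de (cmax _ eH (seq_le_trans cd de)).
Qed.

Lemma add_left_derivable Γ Δ A :
  maximal_in (Γ ⇒ Δ) -> A \in F -> A \notin Γ ->
  derivable ((A +` Γ ⇒ Δ) +` (H `\ (Γ ⇒ Δ))).
Proof.
move=> cmax AF AΓ; have [ov1 ov2] := H_over cmax.1.
apply: extension_derivable => //.
- by split; [apply: subset_add|apply: items_le_refl].
- by split=> //; apply: subset1D.
- by move=> [/(_ A (mset1D1 _ _))]; rewrite (negbTE AΓ).
Qed.

Lemma add_item_derivable Γ Δ x :
  maximal_in (Γ ⇒ Δ) -> item_over F x ->
  ~ (exists2 y, y \in Δ & item_le x y) ->
  derivable ((Γ ⇒ x +` Δ) +` (H `\ (Γ ⇒ Δ))).
Proof.
move=> cmax xF xΔ; have [ov1 ov2] := H_over cmax.1.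
apply: extension_derivable => //.
- by split=> //; apply/items_le_add/items_le_refl.
- by split=> // y; rewrite in_mset1D => /orP[/eqP -> //|/ov2].
- by move=> [_ /(_ x (mset1D1 _ _))].
Qed.

Lemma add_form_derivable Γ Δ A :
  maximal_in (Γ ⇒ Δ) -> A \in F -> fm A \notin Δ ->
  derivable ((Γ ⇒ fm A +` Δ) +` (H `\ (Γ ⇒ Δ))).
Proof.
move=> cmax AF AΔ; apply: add_item_derivable => // -[[B|t] //= BΔ eqA].
by move: AΔ; rewrite eqA BΔ.
Qed.

Lemma add_block_derivable Γ Δ S A :
  maximal_in (Γ ⇒ Δ) -> {subset S <= F} -> A \in F ->
  (forall T, [T ◁ A] \in Δ -> ~ {subset S <= T}) ->
  derivable ((Γ ⇒ [S ◁ A] +` Δ) +` (H `\ (Γ ⇒ Δ))).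
Proof.
move=> cmax SF AF no; apply: add_item_derivable => // -[[B|[T B]] //= TΔ].
by move=> [ST eqA]; apply: (no T) ST; rewrite eqA.
Qed.

Lemma mset1_F A : A \in F -> {subset [mset A] <= F}.
Proof. by move=> AF B /mset1P ->. Qed.

Lemma maximal_impL c A B : maximal_in c -> A → B \in c.1 ->
  B \in c.1 \/ fm A \in c.2.
Proof.
case: c => Γ Δ cmax /= ABΓ; apply/orP; apply: contraT; rewrite negb_or.
move=> /andP[BΓ AΔ]; case: H_und.
have [AF BF] := Imp_F ((H_over cmax.1).1 _ ABΓ).
apply: impL_in cmax.1 ABΓ _ _; first exact: add_left_derivable.
exact: add_form_derivable.
Qed.

Lemma maximal_impR c A B : maximal_in c -> fm (A → B) \in c.2 ->
  A \in c.1 /\ fm B \in c.2.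
Proof.
case: c => Γ Δ cmax /= ABΔ; apply/andP; apply: contraT => no; case: H_und.
have [ov1 ov2] := H_over cmax.1; have [AF BF] := Imp_F (ov2 _ ABΔ).
apply: impR_in cmax.1 ABΔ _; apply: extension_derivable => //.
- by split; [apply: subset_add|apply/items_le_add/items_le_refl].
- split=> [|x]; first exact: subset1D.
  by rewrite in_mset1D => /orP[/eqP ->|/ov2].
- move=> [s1 s2]; case/negP: no; apply/andP; split.
    exact: s1 (mset1D1 _ _).
  exact: items_le_inl s2 (mset1D1 _ _).
Qed.

Lemma maximal_prefL c A B C S : maximal_in c -> A ≼ B \in c.1 ->
  maximal_block c S C ->
  B \in S \/ exists2 T, maximal_block c T A & {subset S <= T}.
Proof.
case: c => Γ Δ cmax /= ABΓ [/= SΔ Smax]; apply: contrapT => no; apply: H_und.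
have [ov1 ov2] := H_over cmax.1; have [AF BF] := Pref_F (ov1 _ ABΓ).
have [/= SF CF] := ov2 _ SΔ.
apply: prefL_in cmax.1 ABΓ SΔ _ _.
  apply: extension_derivable => //.
  - by split=> //; apply: items_le_grow; apply: subset_add.
  - split=> // x; rewrite in_mset1D => /orP[/eqP ->|].
      by split=> //; apply: subset1D.
    by rewrite in_msetB1 => /andP[_ /ov2].
  - move=> [_ s2]; apply: no; left.
    have [T TΔ sub] := items_le_inr s2 (mset1D1 _ _).
    apply: Smax TΔ _ _ (sub _ (mset1D1 _ _)) => D DS.
    exact/sub/mset1Dr.
apply: add_block_derivable => // T TΔ ST; apply: no; right.
have [U Umax TU] := exists_maximal_block cmax.1 TΔ.
by exists U => // D /ST /TU.
Qed.

Lemma maximal_prefR c A B : maximal_in c -> fm (A ≼ B) \in c.2 ->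
  exists2 S, maximal_block c S B & A \in S.
Proof.
case: c => Γ Δ cmax /= ABΔ; apply: contrapT => no; apply: H_und.
have [AF BF] := Pref_F ((H_over cmax.1).2 _ ABΔ).
apply: prefR_in cmax.1 ABΔ _; apply: add_block_derivable => //.
  exact: mset1_F.
move=> T TΔ AT; apply: no.
have [U Umax TU] := exists_maximal_block cmax.1 TΔ.
by exists U => //; apply/TU/AT/mset11.
Qed.

(** Since jp adds a component instead of extending one, maximality of [H] is used directly: the new
    component lies below an old one, hence below a maximal one. *)
Lemma maximal_jp c S A : maximal_in c -> [S ◁ A] \in c.2 ->
  exists2 d, maximal_in d & A \in d.1 /\ forall B, B \in S -> fm B \in d.2.
Proof.
case: c => Γ Δ cmax /= SΔ; have [ov1 ov2] := H_over cmax.1.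
have [/= SF AF] := ov2 _ SΔ.
have le : hyp_le H (([mset A] ⇒ fms S) +` H).
  by move=> c cH; exists c; [apply: mset1Dr|apply: seq_le_refl].
have [| |e eH [s1 s2]] := H_max _ _ le (mset1D1 _ _).
- move=> c; rewrite in_mset1D => /orP[/eqP ->|/H_over //].
  by split=> [|_ /fmsP[B BS ->]]; [apply: mset1_F|apply: SF].
- by move=> dK; apply: H_und; apply: jp_in cmax.1 SΔ dK.
have [d dmax [t1 t2]] := exists_maximal_in eH.
exists d => //; split=> [|B BS]; first exact/t1/s1/mset11.
by apply: items_le_inl t2 _; apply: items_le_inl s2 _; rewrite mem_fms.
Qed.

Lemma maximal_N c : has_ruleN L -> maximal_in c ->
  exists S A, maximal_block c S A.
Proof.
case: c => Γ Δ rL cmax; apply: contrapT => no; apply: H_und.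
apply: N_in rL cmax.1 _; apply: add_block_derivable => //.
  exact: mset1_F.
move=> T TΔ _; apply: no.
have [U Umax _] := exists_maximal_block cmax.1 TΔ.
by exists U, Top.
Qed.

Lemma maximal_T c A B : has_ruleT L -> maximal_in c -> A ≼ B \in c.1 ->
  fm B \in c.2 \/ exists S, maximal_block c S A.
Proof.
case: c => Γ Δ rL cmax /= ABΓ; apply: contrapT => no; apply: H_und.
have [AF BF] := Pref_F ((H_over cmax.1).1 _ ABΓ).
apply: T_in rL cmax.1 ABΓ _ _.
  by apply: add_form_derivable => //; apply/negP => BΔ; apply: no; left.
apply: add_block_derivable => //; first exact: mset1_F.
move=> T TΔ _; apply: no; right.
have [U Umax _] := exists_maximal_block cmax.1 TΔ.
by exists U.
Qed.

Lemma maximal_W c S A B : has_ruleW L -> maximal_in c -> [S ◁ A] \in c.2 ->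
  B \in S -> fm B \in c.2.
Proof.
case: c => Γ Δ rL cmax /= SΔ BS; apply: contrapT => no; apply: H_und.
have [ov1 ov2] := H_over cmax.1; have [/= SF AF] := ov2 _ SΔ.
apply: W_in rL cmax.1 SΔ _; apply: extension_derivable => //.
- by split=> //; apply/items_le_catr/items_le_refl.
- split=> // x; rewrite in_msetD => /orP[/fmsP[D DS ->]|/ov2 //].
  exact: SF.
- move=> [_ s2]; apply: no; apply: items_le_inl s2 _.
  by rewrite in_msetD mem_fms BS.
Qed.

Lemma maximal_C c A B : has_ruleC L -> maximal_in c -> A ≼ B \in c.1 ->
  fm B \in c.2 \/ A \in c.1.
Proof.
case: c => Γ Δ rL cmax /= ABΓ; apply/orP; apply: contraT; rewrite negb_or.
move=> /andP[BΔ AΓ]; case: H_und.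
have [AF BF] := Pref_F ((H_over cmax.1).1 _ ABΓ).
apply: C_in rL cmax.1 ABΓ _ _; first exact: add_form_derivable.
exact: add_left_derivable.
Qed.

(** If the formula were missing from [d], then [c] and [d] would differ and the rule could copy it
    across. *)
Lemma maximal_A c d A B : has_ruleA L -> maximal_in c -> maximal_in d ->
  A ≼ B \in c.1 -> A ≼ B \in d.1.
Proof.
case: d => Γ Δ rL cmax dmax ABc /=; apply: contrapT => /negP no; apply: H_und.
have neq : c != (Γ ⇒ Δ) by apply: contraNneq no => eqc; rewrite eqc in ABc.
apply: (AL_in rL cmax.1 dmax.1 ABc neq).
by apply: add_left_derivable => //; apply: (H_over cmax.1).1.
Qed.

(** * The countermodel *)

Definition cworld : Type := {c | maximal_in c}.

Definition refuting S : classical_sets.set cworld :=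
  fun w => forall A, A \in S -> fm A \in (sval w).2.

(* Adding [w] to the union of the other neighbourhoods of [w] gives (T). *)
Definition reflexive_nbhd (w : cworld) : classical_sets.set cworld :=
  fun v => v = w \/ exists S A, maximal_block (sval w) S A /\ refuting S v.

(* With (A), the blocks of all components are pooled. Only maximal blocks yield
   neighbourhoods: the rule for [≼] on the left enlarges a block in place, so
   non-maximal blocks need not be saturated. *)
Definition cnbhd (w : cworld) : classical_sets.set (classical_sets.set cworld) := fun a =>
  [\/ exists v S A, [/\ v = w \/ has_ruleA L, maximal_block (sval v) S A
        & a = refuting S],
      has_ruleT L /\ a = reflexive_nbhd w
    | has_ruleC L /\ a = [set w]%classic].

Lemma refuting_witness (w : cworld) S A : maximal_block (sval w) S A ->
  exists2 v, refuting S v & A \in (sval v).1.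
Proof.
move=> [Sw _]; have [d dmax [Ad Sd]] := maximal_jp (svalP w) Sw.
by exists (exist _ d dmax).
Qed.

Lemma cnbhd_nonempty w : ~ cnbhd w classical_sets.set0.
Proof.
case=> [[v [S [A [_ Smax eq0]]]]|[_ eq0]|[_ eq0]].
- have [u Su _] := refuting_witness Smax.
  by suff: classical_sets.set0 u by []; rewrite eq0.
- by suff: classical_sets.set0 w by []; rewrite eq0; left.
- by suff: classical_sets.set0 w by []; rewrite eq0.
Qed.

Hypothesis H_neq0 : exists c, c \in H.

Lemma cworld_inhabited : inhabited cworld.
Proof.
by have [c /exists_maximal_in[d dmax _]] := H_neq0; constructor; exists d.
Qed.

Definition countermodel : model Atm :=
  Model (fun p (w : cworld) => Var p \in (sval w).1)
    cworld_inhabited cnbhd_nonempty.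

(** Truth lemma by induction on [A], as two implications, because a component need not contain every
    formula of [F] on one of its sides. *)
Lemma countermodel_truth A (w : world countermodel) :
  (A \in (sval w).1 -> forces w A) /\ (fm A \in (sval w).2 -> ~ forces w A).
Proof.
elim: A w => [p|||] /=.
- move=> w; split=> // pΔ pΓ; apply: H_und.
  case: w pΔ pΓ => -[Γ Δ] [cH _] /= pΔ pΓ.
  exact: init_in cH pΓ pΔ.
- move=> w; split=> [bΓ|_ []]; case: H_und.
  by case: w bΓ => -[Γ Δ] [cH _] /= bΓ; apply: botL_in cH bΓ.
- move=> A IHA B IHB w; split=> [ABΓ fA|ABΔ AB].
    have [/(IHB w).1 //|/(IHA w).2 //] := maximal_impL (svalP w) ABΓ.
  have [/(IHA w).1 fA /(IHB w).2] := maximal_impR (svalP w) ABΔ.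
  by apply; apply: AB.
- move=> A IHA B IHB w; split=> [ABΓ|ABΔ AB].
  (* A world refuting [S] and forcing [B] excludes [B \in S], so saturation gives a block for [A]
     with larger left part [T]; jp supplies a world forcing [A] that refutes [T], hence [S]. *)
  + have block_case (v : cworld) S C : A ≼ B \in (sval v).1 ->
        maximal_block (sval v) S C ->
        (exists2 u : world countermodel, refuting S u & forces u B) ->
        exists2 u : world countermodel, refuting S u & forces u A.
      move=> ABv Smax [u Su fB].
      have [/Su/(IHB u).2 //|[T Tmax ST]] :=
        maximal_prefL (svalP v) ABv Smax.
      have [u' Tu' /(IHA u').1 fA] := refuting_witness Tmax.
      by exists u' => // D /ST; apply: Tu'.
    move=> a [[v [S [C [vw Smax ->]]]]|[rT ->] [v]|[rC ->] [_ -> fB]].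
    * apply: block_case Smax; case: vw => [-> //|rA].
      exact: maximal_A rA (svalP w) (svalP v) ABΓ.
    (* At [w] itself rule T gives a block with right part [A], whose jp witness lies in the
       reflexive neighbourhood; any other point refutes a block of [w]. *)
    * case=> [->|[S [C [Smax Sv]]]] fB.
        have [/(IHB w).2 //|[S Smax]] := maximal_T rT (svalP w) ABΓ.
        have [u Su /(IHA u).1 fA] := refuting_witness Smax.
        by exists u => //; right; exists S, A.
      have [|u Su fA] := block_case _ _ _ ABΓ Smax; first by exists v.
      by exists u => //; right; exists S, C.
    * exists w => //.
      by have [/(IHB w).2 //|/(IHA w).1] := maximal_C rC (svalP w) ABΓ.
  (* Since [A \in S], the neighbourhood [refuting S] contains a world forcing [B] and none forcing
     [A]. *)
  + have [S Smax AS] := maximal_prefR (svalP w) ABΔ.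
    have [v Sv /(IHB v).1 fB] := refuting_witness Smax.
    have [||u Su fA] := AB (refuting S).
    * by apply: Or31; exists w, S, B; split=> //; left.
    * by exists v.
    * exact: (IHA u).2 (Su _ AS) fA.
Qed.

(** Rule W puts [w] into each of its block neighbourhoods; the reflexive neighbourhood gives (T) and
    nonemptiness for (W), and the singleton completes (C). *)
Lemma countermodel_logic : logic_model L countermodel.
Proof.
have condN_of : has_ruleN L -> condN countermodel.
  move=> rN w; have [S [A Smax]] := maximal_N rN (svalP w).
  by exists (refuting S); apply: Or31; exists w, S, A; split=> //; left.
have condA_of : has_ruleA L -> ~~ has_ruleT L -> ~~ has_ruleC L ->
    condA countermodel.
  (* Without T and C only block neighbourhoods remain, and pooling makes them the same at every
     world. *)
  move=> rA rT rC w a v _ _; apply/funext => b; apply/propext.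
  split=> -[[u [S [A [_ Smax ->]]]]|[r _]|[r _]]; rewrite ?r // in rT rC *;
  by apply: Or31; exists u, S, A; split=> //; right.
have in_all w a : has_ruleW L -> ~~ has_ruleA L -> cnbhd w a -> a w.
  move=> rW rA [[v [S [A [vw [Sv _] ->]]]]|[_ ->]|[_ ->]] //; last by left.
  case: vw => [vw|]; last by rewrite (negbTE rA).
  by move=> B BS; rewrite -vw; apply: maximal_W rW (svalP v) Sv BS.
have in_T w : has_ruleT L -> cnbhd w (reflexive_nbhd w) /\ reflexive_nbhd w w.
  by move=> rT; split; [apply: Or32|left].
have in_C w : has_ruleC L -> cnbhd w [set w]%classic by move=> rC; apply: Or33.
case: L condN_of condA_of in_all in_T in_C => //= cN cA cW cT cC.
- exact: cN.
- by move=> w; have [] := cT w isT; exists (reflexive_nbhd w).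
- move=> w; split; last by move=> a; apply: cW.
  by exists (reflexive_nbhd w); have [] := cT w isT.
- by move=> w; split; [apply: cC|move=> a; apply: cW].
- exact: cA.
- by split; [apply: cN|apply: cA].
Qed.

(** Stated for [c] below a component of [H], because the hypersequent to be refuted only lies below
    the maximal one. A maximal component above [c] is a world where the antecedent is forced and
    every succedent item fails. *)
Lemma countermodel_refutes c e : e \in H -> seq_le c e ->
  ~ valid_form countermodel (sequent_interp c).
Proof.
move=> /exists_maximal_in[d dmax ed] ce.
have [le1 le2] := seq_le_trans ce ed.
pose w : world countermodel := exist _ d dmax.
move=> /(_ w) /= valid.
have /valid/forces_bigOr[A] : forces w (bigAnd c.1).
  by apply: forces_bigAnd => A /le1; apply: (countermodel_truth A w).1.
rewrite mem_cat => /orP[|/mapP[[S B]]]; rewrite mem_pmap => /mapP[x xc].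
  case: x xc => // B xc [->]; apply: (countermodel_truth B w).2.
  exact: items_le_inl le2 xc.
case: x xc => // -[S' B'] xc [eqS eqB] -> /=; rewrite -eqS -eqB in xc.
have [T Td ST] := items_le_inr le2 xc.
have [U Umax TU] := exists_maximal_block dmax.1 Td.
have [v Uv Bv] := refuting_witness (w := w) Umax.
(* The neighbourhood of the maximal block above [[S ◁ B]] has a point forcing [B], but all its
   points refute [U] and so every member of [S]. *)
move=> /(_ (refuting U)) [||u Uu /forces_bigOr[C CS]].
- by apply: Or31; exists w, U, B; split=> //; left.
- by exists v => //; apply: (countermodel_truth B v).1.
- by apply: (countermodel_truth C u).2; apply/Uu/TU/ST.
Qed.

End Saturation.

(** * Completeness *)

Section Subformulas.
Variable Atm : countType.
Implicit Types (A B : form Atm) (s : seq (form Atm)) (H : hypersequent Atm).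

Fixpoint subforms A : seq (form Atm) :=
  A :: match A with
       | B → C | B ≼ C => subforms B ++ subforms C
       | _ => [::]
       end.

Definition subforms_closure s : seq (form Atm) := flatten (map subforms s).

Lemma subforms_refl A : A \in subforms A.
Proof. by case: A => *; rewrite mem_head. Qed.

Lemma subforms_Imp A B C : B → C \in subforms A ->
  B \in subforms A /\ C \in subforms A.
Proof.
elim: A => [p||A1 IH1 A2 IH2|A1 IH1 A2 IH2] /=; rewrite !inE ?mem_cat.
- by move=> /eqP.
- by move=> /eqP.
- by move=> /orP[/eqP[-> ->]|/orP[/IH1[-> ->]|/IH2[-> ->]]];
    rewrite ?subforms_refl ?orbT.
- by move=> /orP[/eqP //|/orP[/IH1[-> ->]|/IH2[-> ->]]]; rewrite ?orbT.
Qed.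

Lemma subforms_Pref A B C : B ≼ C \in subforms A ->
  B \in subforms A /\ C \in subforms A.
Proof.
elim: A => [p||A1 IH1 A2 IH2|A1 IH1 A2 IH2] /=; rewrite !inE ?mem_cat.
- by move=> /eqP.
- by move=> /eqP.
- by move=> /orP[/eqP //|/orP[/IH1[-> ->]|/IH2[-> ->]]]; rewrite ?orbT.
- by move=> /orP[/eqP[-> ->]|/orP[/IH1[-> ->]|/IH2[-> ->]]];
    rewrite ?subforms_refl ?orbT.
Qed.

Lemma mem_closure s A : A \in s -> A \in subforms_closure s.
Proof.
move=> As; apply/flattenP; exists (subforms A); first exact: map_f.
exact: subforms_refl.
Qed.

Lemma closure_Imp s A B : A → B \in subforms_closure s ->
  A \in subforms_closure s /\ B \in subforms_closure s.
Proof.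
move=> /flattenP[_ /mapP[C Cs ->] /subforms_Imp[AC BC]].
by split; apply/flattenP; exists (subforms C) => //; apply: map_f.
Qed.

Lemma closure_Pref s A B : A ≼ B \in subforms_closure s ->
  A \in subforms_closure s /\ B \in subforms_closure s.
Proof.
move=> /flattenP[_ /mapP[C Cs ->] /subforms_Pref[AC BC]].
by split; apply/flattenP; exists (subforms C) => //; apply: map_f.
Qed.

Definition item_forms (x : succ_item Atm) : seq (form Atm) :=
  match x with inl A => [:: A] | inr s => s.2 :: s.1 end.

Definition seq_forms (c : sequent Atm) : seq (form Atm) :=
  c.1 ++ flatten (map item_forms c.2).

Definition hyp_forms H : seq (form Atm) :=
  flatten (map seq_forms (enum_mset H)).

Lemma hyp_over_forms H s : {subset hyp_forms H <= s} -> hyp_over s H.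
Proof.
move=> sub c cH.
have {}sub A : A \in seq_forms c -> A \in s.
  move=> Ac; apply: sub; apply/flattenP.
  by exists (seq_forms c) => //; apply: map_f.
split=> [A Ac|x xc]; first by apply: sub; rewrite mem_cat Ac.
have {}sub A : A \in item_forms x -> A \in s.
  move=> Ax; apply: sub; rewrite mem_cat; apply/orP; right.
  by apply/flattenP; exists (item_forms x) => //; apply: map_f.
case: x xc sub => [A|[S A]] _ sub /=; first by apply: sub; rewrite mem_head.
split; last by apply: sub; rewrite mem_head.
by move=> B BS; apply: sub; rewrite inE BS orbT.
Qed.

End Subformulas.

(** The one-point reflexive model meets all conditions. It rules out the empty hypersequent, which
    is valid in no model. *)
Lemma exists_logic_model (Atm : Type) (L : logic) :
  exists M : model Atm, logic_model L M.
Proof.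
pose nb (_ : unit) : classical_sets.set (classical_sets.set unit) :=
  [set [set: unit]]%classic.
have nonempty w : ~ nb w classical_sets.set0.
  by move=> eq0; suff: classical_sets.set0 tt by []; rewrite eq0.
pose M := Model (fun (_ : Atm) _ => True) (inhabits tt) nonempty.
exists M.
have eq1 (w : unit) : [set w]%classic = [set: unit]%classic.
  by apply/funext => v; apply/propext; split=> // _; case: w v => -[].
have cN : condN M by move=> w; exists [set: unit]%classic.
have cA : condA M by [].
have in_all (w : unit) a : nb w a -> a w by move=> ->.
case: L => //=.
- by move=> w; exists [set: unit]%classic.
- by move=> w; split; [apply: cN|apply: in_all].
- by move=> w; split; [apply: eq1|apply: in_all].
Qed.

Theorem theorem5p8 (Atm : countType) (L : logic) (H : hypersequent Atm) :
  (forall M : model Atm, logic_model L M -> valid_hyp M H) ->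
  derivable L H.
Proof.
move=> valid; apply: contrapT => und.
have neq0 : exists c, c \in H.
  have [M /valid[c cH _]] := exists_logic_model Atm L.
  by exists c.
(* Rules N and T introduce the blocks [[[mset Bot] ◁ Top]] and [[[mset Bot] ◁ A]], so [Bot] and
   [Top] are added by hand. *)
pose F := subforms_closure (Bot :: Top :: hyp_forms H).
have Bot_F : Bot \in F by apply: mem_closure; rewrite mem_head.
have Top_F : Top \in F by apply: mem_closure; rewrite !inE eqxx orbT.
have H_over : hyp_over F H.
  by apply: hyp_over_forms => A AH; apply: mem_closure; rewrite !inE AH !orbT.
have [|K [[K_over K_und] HK K_max]] := exists_maximal (@hyp_le_refl Atm)
  (@hyp_le_trans Atm) _ (conj H_over und)
  (P := fun K => hyp_over F K /\ ~ derivable L K) (f := @hyp_shapes _ F).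
  by move=> K K' [ov _] _; apply: hyp_le_shapes.
have {}K_max K' : hyp_over F K' -> ~ derivable L K' -> hyp_le K K' -> hyp_le K' K.
  by move=> ov und' le; apply: K_max.
have K_neq0 : exists c, c \in K.
  by have [c /HK[d dK _]] := neq0; exists d.
have cF := @closure_Imp _ (Bot :: Top :: hyp_forms H).
have cP := @closure_Pref _ (Bot :: Top :: hyp_forms H).
have logicM := countermodel_logic Bot_F Top_F K_over K_und K_max K_neq0.
have [c cH validc] := valid _ logicM.
have [d dK cd] := HK _ cH.
exact: (countermodel_refutes Bot_F cF cP) dK cd validc.
Qed.
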